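(* Let $A=A^*$ and $B=B^*$ be two unbounded self-adjoint operators in a Hilbert space such that their product $AB$ is densely defined and self-adjoint. Then $B$ commutes with $A$, i.e. $BA\subset AB$. If also $D(BA)$ is dense and $BA$ is self-adjoint, then $A$ commutes with $B$, i.e. $AB\subset BA$.
   Context: ''Unbounded operator'' means a linear operator defined on a linear subspace (domain) of a Hilbert space, not necessarily bounded. $S\subset T$ means that $T$ extends $S$. The product $AB$ has domain $D(AB)=\{x\in D(B): Bx\in D(A)\}$. ''$A$ commutes with $B$'' means $AB\subset BA$; ''$B$ commutes with $A$'' means $BA\subset AB$. *)

(* Defs.v *)
From HB Require Import structures.
From mathcomp Require Import all_boot all_order all_algebra.
From mathcomp Require Import complex.
From mathcomp Require Import all_classical all_reals all_analysis.

Set Implicit Arguments.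
Unset Strict Implicit.
Unset Printing Implicit Defensive.

Import Order.TTheory GRing.Theory Num.Theory.
Import numFieldNormedType.Exports.

Local Open Scope classical_set_scope.
Local Open Scope complex_scope.
Local Open Scope ring_scope.

(* Complex Hilbert spaces; [inner] is linear on the left and conjugate-linear on
   the right, and induces the given (complete) norm. *)
HB.mixin Record NormedModule_isHilbert (R : realType) H
    of CompleteNormedModule R[i] H := {
  inner : {dot H for @Num.conj R[i]} ;
  inner_normE : forall x : H, `|x| ^+ 2 = inner x x }.

#[short(type="hilbertType")]
HB.structure Definition Hilbert (R : realType) :=
  {H of CompleteNormedModule R[i] H & NormedModule_isHilbert R H}.

Notation "'[< u , v >]" := (inner u v) : ring_scope.

(* An operator is a linear subspace [dom T] together with a linear map on it.
   The map is totalised: its values outside [dom T] are irrelevant, so that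
   operators are compared with [opeq] and not with Leibniz equality. *)
Record operator (R : realType) (H : hilbertType R) := Operator {
  dom : set H ;
  opfun :> H -> H ;
  dom0 : dom 0 ;
  domP : forall (a : R[i]) x y, dom x -> dom y -> dom (a *: x + y) ;
  opfunP : forall (a : R[i]) x y, dom x -> dom y ->
    opfun (a *: x + y) = a *: opfun x + opfun y }.

Section Operators.
Context {R : realType} {H : hilbertType R}.
Implicit Types S T A B : operator H.

Definition opext S T : Prop :=
  dom S `<=` dom T /\ (forall x, dom S x -> S x = T x).

Definition opeq S T : Prop := opext S T /\ opext T S.

Definition densely_defined T : Prop := dense (dom T).

Section Product.
Variables A B : operator H.

Definition opmul_dom : set H := [set x | dom B x /\ dom A (B x)].

Fact opmul_dom0 : opmul_dom 0.
Proof.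
split; first exact: dom0.
have := opfunP (-1) (dom0 B) (dom0 B).
by rewrite scaleN1r oppr0 addr0 scaleN1r addNr => ->; exact: dom0.
Qed.

Fact opmul_domP (a : R[i]) x y :
  opmul_dom x -> opmul_dom y -> opmul_dom (a *: x + y).
Proof.
move=> [Bx ABx] [By ABy]; split; first exact: domP.
by rewrite opfunP//; exact: domP.
Qed.

Fact opmul_funP (a : R[i]) x y : opmul_dom x -> opmul_dom y ->
  A (B (a *: x + y)) = a *: A (B x) + A (B y).
Proof. by move=> [Bx ABx] [By ABy]; rewrite !opfunP. Qed.

Definition opmul : operator H :=
  @Operator R H opmul_dom (A \o B) opmul_dom0 opmul_domP opmul_funP.

End Product.

Definition adjoint_pair T (y z : H) : Prop :=
  forall x, dom T x -> '[< T x, y >] = '[< x, z >].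

Lemma dense_inner_eq0 (D : set H) (w : H) :
  dense D -> (forall x, D x -> '[< x, w >] = 0) -> w = 0.
Proof.
move=> dD Dw; apply/eqP; apply: contraT => w0.
have [x [/= wx Dx]] : ball w `|w| `&` D !=set0.
  apply: dD; last exact: ball_open.
  by exists w; apply: ballxx; rewrite normr_gt0.
move: wx; rewrite -ball_normE/= => wx.
have wx0 : '[< w, x >] = 0 by rewrite hermC/= expr0 mul1r Dw// conjC0.
suff : `|w| ^+ 2 <= `|w - x| ^+ 2.
  by rewrite ler_pXn2r ?nnegrE// => /le_lt_trans/(_ wx); rewrite ltxx.
rewrite !inner_normE dnormB/= wx0 conjC0 addr0 subr0.
by rewrite lerDl -inner_normE exprn_ge0.
Qed.

Section Adjoint.
Variables (T : operator H) (dT : densely_defined T).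

Lemma adjoint_pair_uniq y z z' :
  adjoint_pair T y z -> adjoint_pair T y z' -> z = z'.
Proof.
move=> Tz Tz'; apply/eqP; rewrite -subr_eq0; apply/eqP.
apply: (dense_inner_eq0 dT) => x Tx.
by rewrite linearBr/= -Tz// -Tz'// subrr.
Qed.

Lemma adjoint_pairP (a : R[i]) y y' z z' :
  adjoint_pair T y z -> adjoint_pair T y' z' ->
  adjoint_pair T (a *: y + y') (a *: z + z').
Proof. by move=> Tz Tz' x Tx; rewrite !linearPr/= Tz// Tz'. Qed.

Definition adjoint_dom : set H := [set y | exists z, adjoint_pair T y z].

Definition adjoint_fun (y : H) : H := xget 0 [set z | adjoint_pair T y z].

Lemma adjoint_funP y : adjoint_dom y -> adjoint_pair T y (adjoint_fun y).
Proof. by move=> [z Tz]; rewrite /adjoint_fun; case: xgetP => [? ->//|/(_ z)]. Qed.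

Fact adjoint_dom0 : adjoint_dom 0.
Proof. by exists 0 => x _; rewrite !linear0r. Qed.

Fact adjoint_domP (a : R[i]) y y' :
  adjoint_dom y -> adjoint_dom y' -> adjoint_dom (a *: y + y').
Proof.
by move=> [z Tz] [z' Tz']; exists (a *: z + z'); exact: adjoint_pairP.
Qed.

Fact adjoint_fun_linear (a : R[i]) y y' : adjoint_dom y -> adjoint_dom y' ->
  adjoint_fun (a *: y + y') = a *: adjoint_fun y + adjoint_fun y'.
Proof.
move=> Ty Ty'; apply: (@adjoint_pair_uniq (a *: y + y')).
  by apply: adjoint_funP; exact: adjoint_domP.
by apply: adjoint_pairP; exact: adjoint_funP.
Qed.

Definition adjoint : operator H :=
  @Operator R H adjoint_dom adjoint_fun
    adjoint_dom0 adjoint_domP adjoint_fun_linear.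

End Adjoint.

Definition selfadjoint T : Prop :=
  exists dT : densely_defined T, opeq T (adjoint dT).

(* [commutes_with A B] reads "A commutes with B"; it is not symmetric. *)
Definition commutes_with A B : Prop := opext (opmul A B) (opmul B A).

End Operators.

(* Main.v *)
Require Import Defs.
From mathcomp Require Import all_boot all_order all_algebra.
From mathcomp Require Import complex.
From mathcomp Require Import all_classical all_reals all_analysis.

(** For densely defined [A], [B] and [A B] one always has
    [B^* A^* ⊂ (A B)^*], by moving first [A] and then [B] across the inner
    product.  When all three operators are self-adjoint the stars disappear and
    the inclusion reads [B A ⊂ A B].  The
    self-adjointness of [A B] is what turns the inclusion, which in general only
    bounds [(A B)^*] from below, into a commutation relation.  The
    converse inclusion is the same fact with [A] and [B] exchanged, and this is
    where the self-adjointness of [B A] enters. *)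

Section AdjointOfProduct.
Context {R : realType} {H : hilbertType R}.
Implicit Types A B T : operator H.

Lemma adjoint_pair_opmul A B (x y z : H) :
  adjoint_pair A x y -> adjoint_pair B y z -> adjoint_pair (opmul A B) x z.
Proof. by move=> Axy Byz u [Bu ABu] /=; rewrite Axy// Byz. Qed.

(** The adjoint is a totalised choice function; over a dense domain it is pinned
    down by the pairing relation that defines it. *)
Lemma adjointE T (dT : densely_defined T) (y z : H) :
  adjoint_pair T y z -> adjoint dT y = z.
Proof.
move=> Tyz; apply: (adjoint_pair_uniq dT _ Tyz).
by apply: adjoint_funP; exists z.
Qed.

(** The graph of a self-adjoint operator is the graph of its adjoint, stated
    without reference to a particular proof of density. *)
Lemma selfadjoint_graphP T (y z : H) : selfadjoint T ->
  (dom T y /\ T y = z) <-> adjoint_pair T y z.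
Proof.
move=> [dT [[sub eqT] [sub' _]]]; split.
  by move=> [Ty <-]; rewrite eqT//; exact/adjoint_funP/sub.
move=> Tyz; have Ty : dom T y by apply: sub'; exists z.
by split=> //; rewrite eqT//; exact: adjointE.
Qed.

Lemma selfadjoint_opmul_commutes A B : selfadjoint A -> selfadjoint B ->
  selfadjoint (opmul A B) -> commutes_with B A.
Proof.
move=> hA hB hAB.
have graphAB x : dom (opmul B A) x ->
    dom (opmul A B) x /\ opmul A B x = opmul B A x.
  move=> [Ax BAx]; apply/(selfadjoint_graphP _ _ _ hAB).
  by apply: (@adjoint_pair_opmul _ _ _ (A x)); exact/selfadjoint_graphP.
by split=> x /graphAB[].
Qed.

End AdjointOfProduct.

Theorem theorem4 (R : realType) (H : hilbertType R) (A B : operator H)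
    (hA : selfadjoint A) (hB : selfadjoint B)
    (dAB : densely_defined (opmul A B)) (hAB : selfadjoint (opmul A B)) :
  commutes_with B A /\
  (densely_defined (opmul B A) -> selfadjoint (opmul B A) -> commutes_with A B).
Proof.
split; first exact: selfadjoint_opmul_commutes.
by move=> _; exact: selfadjoint_opmul_commutes.
Qed.
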